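(* Let $\Sigma$ be a finite first-order signature, $\mathcal{T}$ a $\Sigma$-theory, and $\mathcal{C}$ a class of $\Sigma$-structures. Let $\mathcal{L}_{\mathcal{C}}$ be the $\mathcal{T}$-language of all $\mathcal{T}$-words $\langle\sigma_0,\ldots,\sigma_{n-1}\rangle$ such that $\sigma_i\in\mathcal{C}$ for all $i$. If $\mathcal{C}$ is definable by an existential second-order $\Sigma$-sentence, i.e. there is a sentence $\exists P_1\ldots\exists P_n\,\psi$ with $\psi$ a first-order sentence over $\Sigma\cup\{P_1,\ldots,P_n\}$ such that a $\Sigma$-structure belongs to $\mathcal{C}$ iff it satisfies $\exists P_1\ldots\exists P_n\,\psi$, then $\mathcal{L}_{\mathcal{C}}$ is $\mathcal{T}$-regular.
   Context: Signatures are multi-sorted first-order signatures in which every symbol is marked either rigid or non-rigid. For a signature $\Sigma$, $\Sigma'$ denotes the signature obtained from $\Sigma$ by replacing each non-rigid symbol $s$ by a fresh primed copy $s'$ (rigid symbols are kept); for a $\Sigma$-structure $\sigma$, $\sigma'$ denotes the corresponding renamed $\Sigma'$-structure. For structures over pairwise disjoint signatures with the same sort domains, $\rho\cup\sigma\cup\tau'$ denotes the combined structure over the union of the signatures. A $\Sigma$-theory $\mathcal{T}$ is a set of $\Sigma$-sentences; $[\![\mathcal{T}]\!]$ is the set of all $\Sigma$-structures with finite or countably infinite domains that satisfy $\mathcal{T}$. A $\mathcal{T}$-word is a finite sequence $\bar\sigma=\langle\sigma_0,\ldots,\sigma_{n-1}\rangle$ ($n\ge 0$) of elements of $[\![\mathcal{T}]\!]$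 such that for every sort $S$ and every rigid symbol $s$ of $\Sigma$, $S^{\sigma_i}=S^{\sigma_j}$ and $s^{\sigma_i}=s^{\sigma_j}$ for all $i,j$. $[\![\mathcal{T}]\!]^*$ is the set of all $\mathcal{T}$-words; a $\mathcal{T}$-language is a subset of $[\![\mathcal{T}]\!]^*$. A first-order automaton is a tuple $\mathcal{A}=\langle\Sigma,\Gamma,\phi_0,\phi_T,\phi_F\rangle$ where $\Sigma$ (word signature) and $\Gamma$ (state signature) are finite disjoint signatures, $\phi_0$ and $\phi_F$ are first-order $\Gamma$-sentences, and $\phi_T$ is a first-order $(\Gamma\cup\Sigma\cup\Gamma')$-sentence. Given a $\mathcal{T}$-word $\bar\sigma=\langle\sigma_0,\ldots,\sigma_{n-1}\rangle$, a $\mathcal{T}$-run of $\mathcal{A}$ induced by $\bar\sigma$ is a sequence $\langle\rho_0,\ldots,\rho_n\rangle$ of $\Gamma$-structures such that $S^{\rho_i}=S^{\sigma_0}$ for every sort $S$ and every $i$, rigid symbols of $\Gamma$ are interpreted identically in all $\rho_i$, $\rho_0\models\phi_0$, and $\rho_i\cup\sigma_i\cup\rho'_{i+1}\models\phi_T$ for all $0\le i<n$. $\mathcal{A}$ $\mathcal{T}$-accepts $\bar\sigma$ iff some such run satisfies $\rho_n\models\phi_F$. $\mathcal{L}_{\mathcal{T}}(\mathcal{A})$ is the set of $\mathcal{T}$-words $\mathcal{T}$-accepted by $\mathcal{A}$. A $\mathcal{T}$-language $L$ is $\mathcal{T}$-regular iff $L=\mathcal{L}_{\mathcal{T}}(\mathcal{A})$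 for some first-order automaton $\mathcal{A}$ with word signature $\Sigma$. *)

(* Defs.v *)
From Stdlib Require List.
From mathcomp Require Import all_boot.

Set Implicit Arguments.
Unset Strict Implicit.
Unset Printing Implicit Defensive.

(* Finite multi-sorted first-order signatures over a finite set of sorts [srt].
   Constants are function symbols without arguments.  Signatures that are to be
   combined share [srt]. *)
Record signature (srt : finType) := Signature {
  fsym : finType;
  fargs : fsym -> seq srt;
  fres : fsym -> srt;
  frigid : fsym -> bool;
  psym : finType;
  pargs : psym -> seq srt;
  prigid : psym -> bool }.

(* Symbols have no names here: the union takes the disjoint sum of the symbol
   sets, so its two arguments are disjoint by construction. *)
Definition sig_union (srt : finType) (Sg1 Sg2 : signature srt) :
    signature srt :=
  {| fsym := (fsym Sg1 + fsym Sg2)%type;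
     fargs f := match f with inl g => fargs g | inr g => fargs g end;
     fres f := match f with inl g => fres g | inr g => fres g end;
     frigid f := match f with inl g => frigid g | inr g => frigid g end;
     psym := (psym Sg1 + psym Sg2)%type;
     pargs p := match p with inl q => pargs q | inr q => pargs q end;
     prigid p := match p with inl q => prigid q | inr q => prigid q end |}.

(* The symbols of Sg' that are not already in Sg, i.e. the primed copies of the
   non-rigid symbols of Sg. *)
Definition sig_primed (srt : finType) (Sg : signature srt) : signature srt :=
  {| fsym := {f : fsym Sg | ~~ frigid f};
     fargs f := fargs (val f);
     fres f := fres (val f);
     frigid f := false;
     psym := {p : psym Sg | ~~ prigid p};
     pargs p := pargs (val p);
     prigid p := false |}.

(* Ga \cup Sg \cup Ga': the rigid symbols of Ga, common to Ga and Ga', occur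
   once. *)
Definition sig_step (srt : finType) (Ga Sg : signature srt) : signature srt :=
  sig_union (sig_union Ga Sg) (sig_primed Ga).

(* The signature {P_1, ..., P_n} of predicate symbols of arities [ar]. The
   rigidity mark plays no role in the satisfaction of sentences. *)
Definition sig_preds (srt : finType) (n : nat) (ar : 'I_n -> seq srt) :
    signature srt :=
  {| fsym := void;
     fargs f := match f with end;
     fres f := match f with end;
     frigid f := match f with end;
     psym := 'I_n;
     pargs := ar;
     prigid p := false |}.

(* Formulas with equality, with well-sorted de Bruijn variables: the context
   [c] lists the sorts of the variables that may occur free. *)
Inductive var (srt : finType) : seq srt -> srt -> Type :=
| VarO s c : var (s :: c) s
| VarS s t c : var c s -> var (t :: c) s.

Inductive term (srt : finType) (Sg : signature srt) (c : seq srt) :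
    srt -> Type :=
| TVar s : var c s -> term Sg c s
| TApp (f : fsym Sg) : terms Sg c (fargs f) -> term Sg c (fres f)
with terms (srt : finType) (Sg : signature srt) (c : seq srt) :
    seq srt -> Type :=
| TNil : terms Sg c [::]
| TCons s ss : term Sg c s -> terms Sg c ss -> terms Sg c (s :: ss).

Inductive formula (srt : finType) (Sg : signature srt) : seq srt -> Type :=
| FFalse c : formula Sg c
| FEq c s : term Sg c s -> term Sg c s -> formula Sg c
| FPred c (p : psym Sg) : terms Sg c (pargs p) -> formula Sg c
| FNot c : formula Sg c -> formula Sg c
| FAnd c : formula Sg c -> formula Sg c -> formula Sg c
| FOr c : formula Sg c -> formula Sg c -> formula Sg c
| FImp c : formula Sg c -> formula Sg c -> formula Sg c
| FAll c s : formula Sg (s :: c) -> formula Sg c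
| FEx c s : formula Sg (s :: c) -> formula Sg c.

Definition sentence (srt : finType) (Sg : signature srt) : Type :=
  formula Sg [::].

(* As usual in first-order logic, domains are non-empty. *)
Record domain (srt : finType) := Domain {
  carrier :> srt -> Type;
  carrier_inhabited : forall s, inhabited (carrier s) }.

Fixpoint tup (srt : finType) (D : srt -> Type) (ss : seq srt) : Type :=
  if ss is s :: ss' then (D s * tup D ss')%type else unit.

Record interpretation (srt : finType) (Sg : signature srt) (D : domain srt) :=
  Interpretation {
    fint : forall f : fsym Sg, tup D (fargs f) -> D (fres f);
    pint : forall p : psym Sg, tup D (pargs p) -> Prop }.

Record structure (srt : finType) (Sg : signature srt) := Structure {
  dom : domain srt;
  interp : interpretation Sg dom }.

Fixpoint lookup (srt : finType) (D : srt -> Type) (c : seq srt) (s : srt)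
    (x : var c s) : tup D c -> D s :=
  match x in var c s return tup D c -> D s with
  | VarO _ _ => fun e => e.1
  | VarS _ _ _ y => fun e => lookup y e.2
  end.

Fixpoint eval (srt : finType) (Sg : signature srt) (D : domain srt)
    (I : interpretation Sg D) (c : seq srt) (e : tup D c) (s : srt)
    (t : term Sg c s) {struct t} : D s :=
  match t in term _ _ s return D s with
  | TVar _ x => lookup x e
  | TApp f ts => fint I (evals I e ts)
  end
with evals (srt : finType) (Sg : signature srt) (D : domain srt)
    (I : interpretation Sg D) (c : seq srt) (e : tup D c) (ss : seq srt)
    (ts : terms Sg c ss) {struct ts} : tup D ss :=
  match ts in terms _ _ ss return tup D ss with
  | TNil => tt
  | TCons _ _ t us => (eval I e t, evals I e us)
  end.

Fixpoint sat (srt : finType) (Sg : signature srt) (D : domain srt)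
    (I : interpretation Sg D) (c : seq srt) (phi : formula Sg c) :
    tup D c -> Prop :=
  match phi in formula _ c return tup D c -> Prop with
  | FFalse _ => fun _ => False
  | FEq _ _ t u => fun e => eval I e t = eval I e u
  | FPred _ p ts => fun e => pint I (evals I e ts)
  | FNot _ f => fun e => ~ sat I f e
  | FAnd _ f g => fun e => sat I f e /\ sat I g e
  | FOr _ f g => fun e => sat I f e \/ sat I g e
  | FImp _ f g => fun e => sat I f e -> sat I g e
  | FAll c s f => fun e => forall x : D s, sat I f ((x, e) : tup D (s :: c))
  | FEx c s f => fun e => exists x : D s, sat I f ((x, e) : tup D (s :: c))
  end.

Definition models (srt : finType) (Sg : signature srt) (M : structure Sg)
    (phi : sentence Sg) : Prop :=
  sat (interp M) phi tt.

Definition int_union (srt : finType) (D : domain srt)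
    (Sg1 Sg2 : signature srt) (I1 : interpretation Sg1 D)
    (I2 : interpretation Sg2 D) : interpretation (sig_union Sg1 Sg2) D :=
  @Interpretation srt (sig_union Sg1 Sg2) D
    (fun f => match f with inl g => @fint _ _ _ I1 g
                         | inr g => @fint _ _ _ I2 g end)
    (fun p => match p with inl q => @pint _ _ _ I1 q
                         | inr q => @pint _ _ _ I2 q end).

Definition int_primed (srt : finType) (D : domain srt) (Sg : signature srt)
    (I : interpretation Sg D) : interpretation (sig_primed Sg) D :=
  @Interpretation srt (sig_primed Sg) D
    (fun f => @fint _ _ _ I (val f))
    (fun p => @pint _ _ _ I (val p)).

(* rho \cup sigma \cup tau', for interpretations over a common domain; the
   rigid symbols of Ga are read in rho, with which tau agrees on them. *)
Definition int_step (srt : finType) (D : domain srt) (Ga Sg : signature srt)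
    (rho : interpretation Ga D) (sigma : interpretation Sg D)
    (tau : interpretation Ga D) : interpretation (sig_step Ga Sg) D :=
  int_union (int_union rho sigma) (int_primed tau).

Definition agree_rigid (srt : finType) (Sg : signature srt) (D : domain srt)
    (I J : interpretation Sg D) : Prop :=
  (forall f : fsym Sg, frigid f ->
     forall xs : tup D (fargs f), fint I xs = fint J xs) /\
  (forall p : psym Sg, prigid p ->
     forall xs : tup D (pargs p), pint I xs <-> pint J xs).

Definition theory (srt : finType) (Sg : signature srt) : Type :=
  sentence Sg -> Prop.

Definition countable_domain (srt : finType) (D : domain srt) : Prop :=
  forall s, exists f : D s -> nat, injective f.

(* The set [[T]]. *)
Definition theory_models (srt : finType) (Sg : signature srt)
    (T : theory Sg) (M : structure Sg) : Prop :=
  countable_domain (dom M) /\ forall phi, T phi -> models M phi.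

(* That the structures of a sequence have the same sort domains is expressed by
   writing all of them over one domain [D]. *)
Definition is_word (srt : finType) (Sg : signature srt) (T : theory Sg)
    (w : seq (structure Sg)) : Prop :=
  (forall M, List.In M w -> theory_models T M) /\
  exists (D : domain srt) (n : nat) (sigma : n.-tuple (interpretation Sg D)),
    w = [seq Structure J | J <- sigma] /\
    forall i j : 'I_n, agree_rigid (tnth sigma i) (tnth sigma j).

Definition language (srt : finType) (Sg : signature srt) : Type :=
  seq (structure Sg) -> Prop.

Record automaton (srt : finType) (Sg : signature srt) := Automaton {
  state_sig : signature srt;
  phi_0 : sentence state_sig;
  phi_T : sentence (sig_step state_sig Sg);
  phi_F : sentence state_sig }.

(* [r] is a run of A induced by [w]; [widen_ord (leqnSn n) i] and [lift ord0 i]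
   are the indices i and i + 1 of 'I_n.+1.  For the empty word, the run consists
   of one structure, whose domain is arbitrary. *)
Definition is_run (srt : finType) (Sg : signature srt) (A : automaton Sg)
    (w : seq (structure Sg)) (r : seq (structure (state_sig A))) : Prop :=
  exists (D : domain srt) (n : nat) (sigma : n.-tuple (interpretation Sg D))
         (rho : n.+1.-tuple (interpretation (state_sig A) D)),
    w = [seq Structure J | J <- sigma] /\
    r = [seq Structure J | J <- rho] /\
    (forall i j : 'I_n.+1, agree_rigid (tnth rho i) (tnth rho j)) /\
    models (Structure (tnth rho ord0)) (phi_0 A) /\
    forall i : 'I_n,
      models
        (Structure (int_step (tnth rho (widen_ord (leqnSn n) i))
                             (tnth sigma i) (tnth rho (lift ord0 i))))
        (phi_T A).

Definition accepts (srt : finType) (Sg : signature srt) (A : automaton Sg)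
    (w : seq (structure Sg)) : Prop :=
  exists (r : seq (structure (state_sig A))) (M : structure (state_sig A)),
    is_run w (rcons r M) /\ models M (phi_F A).

Definition automaton_language (srt : finType) (Sg : signature srt)
    (T : theory Sg) (A : automaton Sg) : language Sg :=
  fun w => is_word T w /\ accepts A w.

Definition regular (srt : finType) (Sg : signature srt) (T : theory Sg)
    (L : language Sg) : Prop :=
  exists A : automaton Sg, forall w, L w <-> automaton_language T A w.

Definition class_language (srt : finType) (Sg : signature srt) (T : theory Sg)
    (C : structure Sg -> Prop) : language Sg :=
  fun w => is_word T w /\ forall M, List.In M w -> C M.

(* The second-order sentence exists P_1 ... P_n, psi. *)
Record eso_sentence (srt : finType) (Sg : signature srt) := ESO {
  eso_num : nat;
  eso_arity : 'I_eso_num -> seq srt;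
  eso_matrix : sentence (sig_union Sg (sig_preds eso_arity)) }.

Definition eso_models (srt : finType) (Sg : signature srt) (M : structure Sg)
    (Phi : eso_sentence Sg) : Prop :=
  exists P : interpretation (sig_preds (@eso_arity _ _ Phi)) (dom M),
    models (Structure (int_union (interp M) P)) (eso_matrix Phi).

Definition eso_definable (srt : finType) (Sg : signature srt)
    (C : structure Sg -> Prop) : Prop :=
  exists Phi : eso_sentence Sg, forall M, C M <-> eso_models M Phi.

(* Main.v *)
(* The automaton keeps the second-order witnesses P_1, ..., P_n as its state.
   They are non-rigid, so it can guess fresh witnesses at each position; its
   transition formula is psi, read over the word letter and the current state,
   while the primed state and the initial and final states are unconstrained. *)
Require Import Defs.
From mathcomp Require Import all_boot.

Set Implicit Arguments.
Unset Strict Implicit.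
Unset Printing Implicit Defensive.

Section Translation.

Variables (srt : finType) (S1 S2 : signature srt).

(* Symbols are sent to term and formula constructors rather than to symbols, so
   that no equality between arities has to be transported. *)
Record translation := Translation {
  tr_app (f : Defs.fsym S1) c : terms S2 c (fargs f) -> term S2 c (fres f);
  tr_pred (p : psym S1) c : terms S2 c (pargs p) -> formula S2 c }.

Variable h : translation.

Fixpoint translate_term c s (t : term S1 c s) : term S2 c s :=
  match t in term _ _ s return term S2 c s with
  | TVar _ x => TVar S2 x
  | TApp f ts => tr_app h (translate_terms ts)
  end
with translate_terms c ss (ts : terms S1 c ss) : terms S2 c ss :=
  match ts in terms _ _ ss return terms S2 c ss with
  | TNil => TNil S2 c
  | TCons _ _ t us => TCons (translate_term t) (translate_terms us)
  end.

Fixpoint translate c (phi : formula S1 c) : formula S2 c :=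
  match phi in formula _ c return formula S2 c with
  | FFalse c => FFalse S2 c
  | FEq _ _ t u => FEq (translate_term t) (translate_term u)
  | FPred _ p ts => tr_pred h (translate_terms ts)
  | FNot _ f => FNot (translate f)
  | FAnd _ f g => FAnd (translate f) (translate g)
  | FOr _ f g => FOr (translate f) (translate g)
  | FImp _ f g => FImp (translate f) (translate g)
  | FAll _ _ f => FAll (translate f)
  | FEx _ _ f => FEx (translate f)
  end.

Variable D : domain srt.

Record is_reduct (I1 : interpretation S1 D) (I2 : interpretation S2 D) :
    Prop := IsReduct {
  eval_tr_app : forall f c (e : tup D c) (ts : terms S2 c (fargs f)),
    eval I2 e (tr_app h ts) = fint I1 (evals I2 e ts);
  sat_tr_pred : forall p c (e : tup D c) (ts : terms S2 c (pargs p)),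
    sat I2 (tr_pred h ts) e <-> pint I1 (evals I2 e ts) }.

Variables (I1 : interpretation S1 D) (I2 : interpretation S2 D).
Hypothesis reductI : is_reduct I1 I2.

Fixpoint eval_translate_term c (e : tup D c) s (t : term S1 c s) {struct t} :
  eval I2 e (translate_term t) = eval I1 e t
with evals_translate_terms c (e : tup D c) ss (ts : terms S1 c ss)
    {struct ts} :
  evals I2 e (translate_terms ts) = evals I1 e ts.
Proof.
- by case: t => //= f ts; rewrite (eval_tr_app reductI) evals_translate_terms.
- case: ts => //= s ss' t us.
  by rewrite eval_translate_term evals_translate_terms.
Qed.

Lemma sat_translate c (phi : formula S1 c) (e : tup D c) :
  sat I2 (translate phi) e <-> sat I1 phi e.
Proof.
elim: phi e => {c} [c|c s t u|c p ts|c f IHf|c f IHf g IHg|c f IHf g IHg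
  |c f IHf g IHg|c s f IHf|c s f IHf] e /=.
- by [].
- by rewrite !eval_translate_term.
- by rewrite -evals_translate_terms; apply: sat_tr_pred.
- by rewrite IHf.
- by rewrite IHf IHg.
- by rewrite IHf IHg.
- by rewrite IHf IHg.
- by split=> fP x; apply/IHf.
- by split=> -[x /IHf fP]; exists x.
Qed.

End Translation.

Lemma interpretation_inhabited (srt : finType) (Sg : signature srt)
    (D : domain srt) : inhabited (interpretation Sg D).
Proof.
have /fin_all_exists[d _]: forall s : srt, exists x : D s, True.
  by move=> s; have [x] := carrier_inhabited D s; exists x.
by split; split=> [f _|p _]; [exact: d | exact: False].
Qed.

Definition all_nonrigid (srt : finType) (Sg : signature srt) : Prop :=
  (forall f : Defs.fsym Sg, ~~ frigid f) /\ forall p : psym Sg, ~~ prigid p.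

Lemma agree_rigid_nonrigid (srt : finType) (Sg : signature srt)
    (D : domain srt) (I J : interpretation Sg D) :
  all_nonrigid Sg -> agree_rigid I J.
Proof. by case=> nrf nrp; split=> [f /(negP (nrf f))|p /(negP (nrp p))]. Qed.

Lemma all_nonrigid_preds (srt : finType) n (ar : 'I_n -> seq srt) :
  all_nonrigid (sig_preds ar).
Proof. by split=> // -[]. Qed.

Lemma In_map_tnth (A B : Type) (f : A -> B) n (t : n.-tuple A) (y : B) :
  List.In y [seq f x | x <- t] <-> exists i, f (tnth t i) = y.
Proof.
elim: n t => [|n IHn] t; first by rewrite tuple0; split=> // -[[]].
case/tupleP: t => x t /=; rewrite IHn; split=> [[fx|[i fi]]|[i]].
- by exists ord0; rewrite tnth0.
- by exists (lift ord0 i); rewrite tnthS.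
- case: (unliftP ord0 i) => [j|] ->; rewrite ?tnth0 ?tnthS; last by left.
  by right; exists j.
Qed.

Lemma run_accepts (srt : finType) (Sg : signature srt) (A : automaton Sg)
    (D : domain srt) n (sigma : n.-tuple (interpretation Sg D))
    (rho : n.+1.-tuple (interpretation (state_sig A) D)) :
    (forall i j, agree_rigid (tnth rho i) (tnth rho j)) ->
    models (Structure (tnth rho ord0)) (phi_0 A) ->
    (forall i : 'I_n,
      models (Structure (int_step (tnth rho (widen_ord (leqnSn n) i))
                           (tnth sigma i) (tnth rho (lift ord0 i))))
        (phi_T A)) ->
    models (Structure (tnth rho ord_max)) (phi_F A) ->
  accepts A [seq Structure J | J <- sigma].
Proof.
move=> rigid_rho init_rho step_rho final_rho.
pose prefix :=
  [seq Structure (tnth rho (widen_ord (leqnSn n) i)) | i <- enum 'I_n].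
exists prefix, (Structure (tnth rho ord_max)); split=> //.
exists D, n, sigma, rho; split=> //; split=> //.
by rewrite -[tval rho]map_tnth_enum enum_ordSr !map_rcons -2!map_comp.
Qed.

Section ExpansionClass.

Variables (srt : finType) (Sg Ga : signature srt).

Definition has_expansion (psi : sentence (sig_union Sg Ga))
    (M : structure Sg) : Prop :=
  exists P : interpretation Ga (dom M),
    models (Structure (int_union (interp M) P)) psi.

Definition current_state : translation (sig_union Sg Ga) (sig_step Ga Sg) :=
  @Translation srt (sig_union Sg Ga) (sig_step Ga Sg)
    (fun f => match f with
      | inl g => fun c ts => @TApp srt (sig_step Ga Sg) c (inl (inr g)) ts
      | inr g => fun c ts => @TApp srt (sig_step Ga Sg) c (inl (inl g)) ts
      end)
    (fun p => match p with
      | inl q => fun c ts => @FPred srt (sig_step Ga Sg) c (inl (inr q)) ts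
      | inr q => fun c ts => @FPred srt (sig_step Ga Sg) c (inl (inl q)) ts
      end).

Lemma is_reduct_current_state (D : domain srt) (sigma : interpretation Sg D)
    (rho tau : interpretation Ga D) :
  is_reduct current_state (int_union sigma rho) (int_step rho sigma tau).
Proof. by split=> -[]. Qed.

Variable psi : sentence (sig_union Sg Ga).

Definition expansion_automaton : automaton Sg :=
  @Automaton srt Sg Ga (FNot (FFalse _ _)) (translate current_state psi)
    (FNot (FFalse _ _)).

Lemma models_expansion_step (D : domain srt) (sigma : interpretation Sg D)
    (rho tau : interpretation Ga D) :
  models (Structure (int_step rho sigma tau)) (phi_T expansion_automaton) <->
  models (Structure (int_union sigma rho)) psi.
Proof. exact: (sat_translate (is_reduct_current_state sigma rho tau)). Qed.

Lemma accepts_has_expansion (w : seq (structure Sg)) :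
  accepts expansion_automaton w -> forall M, List.In M w -> has_expansion psi M.
Proof.
move=> [r [N [[D [n [sigma [rho [-> [_ [_ [_ stepP]]]]]]]] _]]] M.
move=> /In_map_tnth[i <-]; exists (tnth rho (widen_ord (leqnSn n) i)).
exact/models_expansion_step/stepP.
Qed.

Hypothesis nonrigid_state : all_nonrigid Ga.

Lemma has_expansion_accepts (D : domain srt) n
    (sigma : n.-tuple (interpretation Sg D)) :
  (forall i, has_expansion psi (Structure (tnth sigma i))) ->
  accepts expansion_automaton [seq Structure J | J <- sigma].
Proof.
move=> /fin_all_exists[P satP]; have [P0] := interpretation_inhabited Ga D.
(* The last state reads no letter, so its witnesses are arbitrary. *)
pose rho : n.+1.-tuple (interpretation Ga D) :=
  [tuple (if insub (val i) is Some j then P j else P0) | i < n.+1].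
apply: (@run_accepts _ _ expansion_automaton _ _ _ rho) => [i j|[]|i|[]].
  exact: agree_rigid_nonrigid.
by apply/models_expansion_step; rewrite tnth_mktuple /= valK; apply: satP.
Qed.

Lemma regular_has_expansion (T : theory Sg) :
  regular T (class_language T (has_expansion psi)).
Proof.
exists expansion_automaton => w; split=> -[wT wP]; split=> //.
  have [_ [D [n [sigma [wE _]]]]] := wT; rewrite wE in wP *.
  by apply: has_expansion_accepts => i; apply/wP/In_map_tnth; exists i.
exact: accepts_has_expansion.
Qed.

End ExpansionClass.

Theorem theorem3 (srt : finType) (Sg : signature srt) (T : theory Sg)
    (C : structure Sg -> Prop) :
  eso_definable C -> regular T (class_language T C).
Proof.
move=> [Phi CE].
have [A AE] := regular_has_expansion (eso_matrix Phi) (all_nonrigid_preds _) T.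
by exists A => w; rewrite -AE; split=> -[wT wC]; split=> // M /wC /CE.
Qed.
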